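(* Let $m$ be a positive integer and let $\delta$ be a positive divisor of $\lambda(m)$. Then $$\prod_{\substack{a\in U_m\\ \mathrm{ind}_m(a)=\delta}}a\equiv\begin{cases}-1\pmod m,&\text{if }\delta=2\text{ and }m\text{ has a primitive root,}\\ 1\pmod m,&\text{otherwise.}\end{cases}$$
   Context: $U_m$ denotes the set of invertible residue classes in $\mathbb{Z}/m\mathbb{Z}$ (the product runs over one representative of each such class). For $a$ coprime to $m$, $\mathrm{ind}_m(a)$ is the multiplicative order of $a$ modulo $m$, i.e. the smallest positive $k$ with $a^k\equiv 1\pmod m$. $\lambda(m)$ is the Carmichael function: the smallest $k>0$ such that $a^k\equiv 1\pmod m$ for all $a\in U_m$. A primitive root modulo $m$ is an element of $U_m$ of order $\phi(m)$, where $\phi$ is Euler's totient function. *)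

(* Defs.v *)
From mathcomp Require Import all_boot.
Set Implicit Arguments. Unset Strict Implicit. Unset Printing Implicit Defensive.

(* Multiplicative order of a modulo m (m > 0, coprime a m): the least k > 0
   with a^k = 1 (mod m).  Such a k always lies in [1, m] (k <= totient m <= m),
   so it is found by searching 1..m. *)
Definition ind_mod (m a : nat) : nat :=
  (find (fun k => a ^ k == 1 %[mod m]) (iota 1 m)).+1.

(* Carmichael function: least k > 0 with a^k = 1 (mod m) for all a in U_m
   (again k <= totient m <= m). *)
Definition carmichael (m : nat) : nat :=
  (find (fun k => [forall a : 'I_m, coprime a m ==> (a ^ k == 1 %[mod m])])
        (iota 1 m)).+1.

Definition has_primitive_root (m : nat) : Prop :=
  exists2 a, a < m & coprime a m && (ind_mod m a == totient m).

(* Main.v *)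
Require Import Defs.
From mathcomp Require Import all_boot zify.
From mathcomp Require Import all_algebra all_fingroup all_solvable.

(* For delta > 2 the elements of order delta cancel in pairs x, x^-1.  For
   delta = 2 the product is that of all the square roots of 1.  Pairing them as
   x, u x shows that it is 1 or u, for every u <> 1 with u^2 = 1; taking u = -1,
   it can differ from 1 only if -1 is the unique element of order 2.  Conversely
   that uniqueness forces m to be 4, p^k or 2 p^k, hence to have a primitive
   root, while in a cyclic group the element of order 2 is unique. *)

Set Implicit Arguments. Unset Strict Implicit. Unset Printing Implicit Defensive.
Import GRing.Theory.

(** * Multiplicative orders and the ring of residues *)

(** Euler's theorem and [totient m <= m] make the search succeed, at some exponent [d.+1]. Powers of
    [a] then depend only on the exponent modulo [d.+1], and minimality excludes a positive
    remainder. *)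
Lemma ind_mod_dvdn (m a k : nat) : 0 < m -> coprime a m ->
  (ind_mod m a %| k) = (a ^ k == 1 %[mod m]).
Proof.
move=> m_gt0 co_am; rewrite /ind_mod; set p := fun k => _; set d := find p _.
have has_p : has p (iota 1 m).
  apply/hasP; exists (totient m); last exact/eqP/Euler_exp_totient.
  rewrite mem_iota totient_gt0 m_gt0 add1n ltnS totient_count_coprime.
  rewrite -[leqRHS]muln1 -[X in (X * 1)%N]subn0 -sum_nat_const_nat.
  by apply: leq_sum => i _; case: (coprime m i).
have lt_dm : d < m by rewrite -[ltnRHS](size_iota 1 m) -has_find.
have /eqP pd : p d.+1 by have := nth_find 0 has_p; rewrite nth_iota ?add1n.
have expE e : a ^ e = a ^ (e %% d.+1) %[mod m].
  rewrite {1}(divn_eq e d.+1) expnD mulnC expnM -modnMmr expnAC -modnXm pd.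
  by rewrite modnXm exp1n modnMmr muln1.
apply/idP/idP => [/eqP k0|]; first by apply/eqP; rewrite expE k0.
rewrite expE /dvdn; case: (posnP (k %% d.+1)) => [->//|r_gt0] pr.
have lt_rd : (k %% d.+1).-1 < d.
  by rewrite -ltnS (ltn_predK r_gt0) ltn_pmod.
have := before_find 0 lt_rd; rewrite nth_iota ?(ltn_trans lt_rd) //.
by rewrite add1n (ltn_predK r_gt0) /p pr.
Qed.

Lemma ind_mod_gt0 (m a : nat) : 0 < ind_mod m a.
Proof. by []. Qed.

Local Open Scope ring_scope.

(** Each pair [i], [s i] has exactly one member of smaller [enum_rank]; [k] counts the pairs. *)
Lemma prod_involution (R : comNzRingType) (I : finType) (P : pred I)
    (F : I -> R) (s : I -> I) (c : R) :
    involutive s -> (forall i, P (s i) = P i) ->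
    (forall i, P i -> s i != i) -> (forall i, P i -> F i * F (s i) = c) ->
  exists k, \prod_(i | P i) F i = c ^+ k.
Proof.
move=> sK Ps s_neq Fs; pose low i := (enum_rank i < enum_rank (s i))%N.
exists #|[pred i | P i && low i]|; rewrite (bigID low) /= -prodr_const.
rewrite [X in _ * X](reindex_inj (inv_inj sK)) /=.
rewrite [X in _ * X](eq_bigl (fun i => P i && low i)) => [|i].
  by rewrite -big_split; apply: eq_bigr => i /andP[/Fs].
rewrite Ps /low sK -leqNgt leq_eqVlt; case Pi: (P i) => //=.
by rewrite (inj_eq val_inj) (inj_eq enum_rank_inj) eq_sym (negPf (s_neq i Pi)).
Qed.

Lemma eqn_mod_Zp (n a b : nat) :
  (a == b %[mod n.+2])%N = (a%:R == b%:R :> 'Z_(n.+2)).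
Proof. by rewrite -val_eqE /= !val_Zp_nat. Qed.

Lemma coprime_Zp (n : nat) (x : 'Z_(n.+2)) :
  coprime x n.+2 = (x \is a GRing.unit).
Proof. by rewrite coprime_sym -unitZpE // natr_Zp. Qed.

Lemma ind_mod_Zp (n k : nat) (x : 'Z_(n.+2)) : x \is a GRing.unit ->
  (ind_mod n.+2 x %| k)%N = (x ^+ k == 1).
Proof.
by move=> Ux; rewrite ind_mod_dvdn ?coprime_Zp // eqn_mod_Zp natrX natr_Zp.
Qed.

Lemma ind_mod_order (n : nat) (u : {unit 'Z_(n.+2)}) :
  ind_mod n.+2 (val u) = #[u]%g.
Proof.
have dvdE k : (ind_mod n.+2 (val u) %| k = (#[u]%g %| k))%N.
  rewrite ind_mod_Zp ?(valP u) // order_dvdn -FinRing.val_unitX.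
  exact: (inj_eq val_inj (u ^+ k)%g 1%g).
by apply/eqP; rewrite eqn_dvd dvdE dvdnn -dvdE dvdnn.
Qed.

Lemma has_primitive_root_cyclic (n : nat) :
  has_primitive_root n.+2 <-> cyclic (units_Zp n.+2).
Proof.
split=> [[a lt_am /andP[co_a /eqP ind_a]] | /cyclicP[u defU]].
  pose x : 'Z_(n.+2) := Ordinal lt_am.
  have Ux : x \is a GRing.unit by rewrite -coprime_Zp.
  pose u := FinRing.unit _ Ux; apply/cyclicP; exists u; apply/esym/eqP.
  by rewrite eqEcard subsetT card_units_Zp // -orderE -ind_mod_order ind_a leqnn.
exists (val u : nat); first exact: ltn_ord.
by rewrite coprime_Zp (valP u) ind_mod_order orderE -defU card_units_Zp ?eqxx.
Qed.

(** * Square roots of 1 and existence of primitive roots *)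

(** The unit group is the automorphism group of a cyclic group of order [p ^ k], whose structure is
    known. *)
Lemma cyclic_units_odd_pfactor (p k : nat) : prime p -> odd p -> (0 < k)%N ->
  cyclic (units_Zp (p ^ k)).
Proof.
move=> p_pr p_odd k_gt0; have q_gt1 : (1 < p ^ k)%N.
  by rewrite (leq_trans (prime_gt1 p_pr)) // -{1}(expn1 p) leq_exp2l ?prime_gt1.
case q_def: (p ^ k)%N q_gt1 => [|[|q]] // _.
have o1 := order_Zp1 q.+1.
have := Zp_unit_isog (Zp1 : 'I_q.+2); rewrite o1 => /isog_cyclic->.
have pG : (p.-group <[Zp1 : 'I_q.+2]>)%g.
  by rewrite /pgroup -orderE o1 -q_def pnatX pnat_id.
have [|f [_ [_ cycF _ _]]] := cyclic_pgroup_Aut_structure pG (cycle_cyclic _).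
  by rewrite -cardG_gt1 -orderE o1.
(* For [k = 1] the automorphism group equals its cyclic part of order [p - 1]; for larger [k] the
   oddness of [p] decides. *)
rewrite [X in cyclic X]/=; case: ifP => [_ AF | _ [t [_ _ _]]].
  by rewrite AF.
by rewrite p_odd => -[[]].
Qed.

Local Close Scope ring_scope.

(** Both unit groups have the same order. The odd one among [a] and [a + q] is a unit modulo [2 * q]
    that reduces to [a] modulo [q], so its order is a multiple of that of [a]. *)
Lemma has_primitive_root_double (q : nat) : odd q ->
  has_primitive_root q -> has_primitive_root (2 * q).
Proof.
move=> q_odd [a lt_aq /andP[co_aq /eqP ind_a]]; have q_gt0 := odd_gt0 q_odd.
pose b := if odd a then a else a + q.
have b_odd : odd b by rewrite /b; case: ifPn; rewrite // oddD q_odd => /negPf->.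
have b_mod : b = a %[mod q] by rewrite /b; case: ifP; rewrite // modnDr.
have co_b : coprime b (2 * q).
  by rewrite coprimeMr coprimen2 b_odd -coprime_modl b_mod coprime_modl.
have tot_q : totient (2 * q) = totient q.
  by rewrite totient_coprime ?coprime2n // mul1n.
exists b; first by rewrite /b; case: ifP => _; lia.
rewrite co_b eqn_dvd ind_mod_dvdn ?muln_gt0 ?q_gt0 //.
rewrite Euler_exp_totient // eqxx tot_q -ind_a ind_mod_dvdn //=.
have: ind_mod (2 * q) b %| ind_mod (2 * q) b by [].
rewrite [in X in X -> _]ind_mod_dvdn ?muln_gt0 ?q_gt0 // => /eqP b1.
by rewrite -modnXm -b_mod modnXm -(modn_dvdm _ (dvdn_mull 2 (dvdnn q))) b1
  modn_dvdm ?dvdn_mull.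
Qed.

(** Take [x] congruent to 1 modulo [a] and to -1 modulo [b]; the bounds keep 1 and -1 distinct
    modulo each factor. *)
Lemma sqrt1_coprime_split (a b : nat) : coprime a b -> 2 < a -> 2 < b ->
  exists2 x, x ^ 2 = 1 %[mod a * b] &
    ~ (x = 1 %[mod a * b] \/ a * b %| x.+1).
Proof.
move=> co_ab a_gt2 b_gt2; pose x := chinese a b 1 b.-1.
have xa : x = 1 %[mod a] by apply: chinese_modl.
have xb : x = b.-1 %[mod b] by apply: chinese_modr.
exists x.
  apply/eqP; rewrite chinese_remainder // -modnXm xa modnXm eqxx /=.
  rewrite -modnXm xb modnXm; apply/eqP.
  have -> : b.-1 ^ 2 = (b - 2) * b + 1 by nia.
  by rewrite modnMDl.
case=> [/eqP | ]; first rewrite chinese_remainder //.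
  by case/andP=> _ /eqP; rewrite xb !modn_small; lia.
move/(dvdn_trans (dvdn_mulr b (dvdnn a))).
by rewrite -addn1 /dvdn -modnDml xa modnDml modn_small.
Qed.

Lemma sqrt1_pow2 (k : nat) : 2 < k ->
  exists2 x, x ^ 2 = 1 %[mod 2 ^ k] & ~ (x = 1 %[mod 2 ^ k] \/ 2 ^ k %| x.+1).
Proof.
case: k => [|[|[|k]]] // _; pose h := 2 ^ k.
have h_gt0 : 0 < h by rewrite expn_gt0.
have -> : 2 ^ k.+3 = 8 * h by rewrite -addn3 expnD mulnC.
(* This is 1 plus half the modulus. *)
exists (4 * h + 1).
  have -> : (4 * h + 1) ^ 2 = (2 * h + 1) * (8 * h) + 1 by nia.
  by rewrite modnMDl.
case; first by rewrite !modn_small; lia.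
by move/dvdn_leq; lia.
Qed.

(* Two coprime factors greater than 2, or a factor 8 of a power of 2, would
   give a square root of 1 other than 1 and -1; this leaves the moduli
   1, 2, 4, p^k and 2 p^k. *)
Lemma sqrt1_has_primitive_root (m : nat) : 2 < m ->
    (forall x, x ^ 2 = 1 %[mod m] -> x = 1 %[mod m] \/ m %| x.+1) ->
  has_primitive_root m.
Proof.
move=> m_gt2 sqrt1; have m_gt0 : 0 < m by lia.
have m_part := partnC 2 m_gt0.
have [odd1 | odd_gt1] := leqP m`_2^' 1; last first.
  pose p := pdiv m`_2^'; have p_pr : prime p := pdiv_prime odd_gt1.
  have p_odd : odd p.
    have := pnat_dvd (pdiv_dvd m`_2^') (part_pnat 2^' m).
    rewrite -/p pnatE // inE /= => p2.
    by case: (even_prime p_pr) => // p_eq2; rewrite p_eq2 in p2.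
  have [n co_pn def_m] := pfactor_coprime p_pr m_gt0.
  have k_gt0 : 0 < logn p m.
    rewrite logn_gt0 mem_primes p_pr m_gt0.
    by rewrite (dvdn_trans (pdiv_dvd _)) ?dvdn_part.
  move: (logn p m) k_gt0 def_m => k k_gt0 def_m.
  have pk_gt2 : 2 < p ^ k.
    rewrite (leq_trans (odd_prime_gt2 p_odd p_pr)) // -{1}(expn1 p).
    by rewrite leq_exp2l ?prime_gt1.
  have root_pk : has_primitive_root (p ^ k).
    have := cyclic_units_odd_pfactor p_pr p_odd k_gt0.
    by case: (p ^ k) pk_gt2 => [|[|q]] // _ /has_primitive_root_cyclic.
  (* A cofactor above 2 would give a forbidden square root of 1, which leaves the cofactors 1 and
     2. *)
  have [n_gt2 | n_le2] := ltnP 2 n.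
    have co : coprime n (p ^ k) by rewrite coprime_sym coprimeXl.
    have [x x2 []] := sqrt1_coprime_split co n_gt2 pk_gt2.
    by rewrite -def_m in x2 *; apply: sqrt1.
  case: n n_le2 def_m {co_pn} => [|[|[|]]] // _ def_m; rewrite def_m.
  - by rewrite def_m in m_gt0.
  - by rewrite mul1n.
  - by apply: has_primitive_root_double; rewrite // oddX p_odd orbT.
have m_pow : m = 2 ^ logn 2 m.
  by rewrite -p_part -{1}m_part; have := part_gt0 2^' m; nia.
move: (logn 2 m) m_pow => k def_m; have [k_gt2 | k_le2] := ltnP 2 k.
  have [x x2 []] := sqrt1_pow2 k_gt2.
  by rewrite -def_m in x2 *; apply: sqrt1.
(* As [m] exceeds 2, only [m = 4] remains, with primitive root 3. *)
case: k k_le2 def_m => [|[|[|]]] // _ def_m; rewrite def_m // in m_gt2 *.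
by exists 3.
Qed.

(** * Products over elements of given order *)

Local Open Scope ring_scope.

(** A cyclic group has at most one subgroup of order 2, so [x], if not 1, generates the same
    subgroup as -1. The modulus is at least 3, so -1 differs from 1. *)
Lemma cyclic_units_sqrt1 (n : nat) (x : 'Z_(n.+3)) :
  cyclic (units_Zp n.+3) -> x ^+ 2 = 1 -> x = 1 \/ x = -1.
Proof.
move=> cycU x2; have [->|x_neq1] := eqVneq x 1; [by left | right].
have N1_neq1 : -1 != 1 :> 'Z_(n.+3).
  by rewrite -val_eqE /= !modn_small.
have ord2 (y : 'Z_(n.+3)) : y ^+ 2 = 1 -> y != 1 ->
    exists2 u : {unit 'Z_(n.+3)}, val u = y & #[u]%g = 2%N.
  move=> y2 y_neq1; have Uy : y \is a GRing.unit.
    by apply/unitrP; exists y; rewrite -expr2.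
  exists (FinRing.unit _ Uy); first by [].
  apply: nt_prime_order => //.
  by apply: val_inj; rewrite FinRing.val_unitX.
have [u <- ou] := ord2 x x2 x_neq1.
have [v <- ov] := ord2 (-1) (etrans (sqrrN 1) (expr1n _ _)) N1_neq1.
have /eqP uv : <[u]>%g == <[v]>%g.
  by rewrite (eq_subG_cyclic cycU) ?subsetT // -!orderE ou ov.
have : u \in <[v]>%g by rewrite -uv cycle_id.
rewrite cycle2g // !inE => /orP[/eqP u1 | /eqP-> //].
by move: ou; rewrite u1 order1.
Qed.

(** Each pair [x], [u * x] has product [u], so [p] is a power of [u], and only the parity of the
    exponent matters. *)
Lemma prod_sqrt1 (n : nat) (u : 'Z_(n.+2)) : u ^+ 2 = 1 -> u != 1 ->
  let p := \prod_(x : 'Z_(n.+2) | x ^+ 2 == 1) x in p = 1 \/ p = u.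
Proof.
move=> u2 u_neq1 p; have uK : involutive ( *%R u).
  by move=> x; rewrite mulrA -expr2 u2 mul1r.
have [k pk] : exists k, p = u ^+ k.
  apply: (prod_involution (s := *%R u)) => // x.
  - by rewrite exprMn u2 mul1r.
  - move=> /eqP x2; apply: contra u_neq1 => /eqP ux.
    by rewrite -[u]mulr1 -x2 expr2 mulrA ux.
  - by move=> /eqP x2; rewrite mulrCA -expr2 x2 mulr1.
rewrite pk -(odd_double_half k) exprD -mul2n exprM u2 expr1n mulr1.
by case: odd; [right | left].
Qed.

Lemma prod_ind_mod_Zp (n delta : nat) (i := ind_mod n.+2) :
  (\prod_(a < n.+2 | coprime a n.+2 && (i a == delta)) (a : nat))%:R
  = \prod_(x : 'Z_(n.+2) | (x \is a GRing.unit) && (i x == delta)) x :> 'Z_(n.+2).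
Proof.
rewrite natr_prod; apply: eq_big => [x | x _]; first by rewrite coprime_Zp.
by rewrite natr_Zp.
Qed.

(** Inversion preserves the order, and a fixed point of it would have order dividing 2. *)
Lemma prod_ind_mod_gt2 (n delta : nat) : (2 < delta)%N ->
  \prod_(x : 'Z_(n.+2) | (x \is a GRing.unit) && (ind_mod n.+2 x == delta)) x
    = 1.
Proof.
move=> delta_gt2.
have [||x|x|k ->] := prod_involution (F := id) (s := @GRing.inv 'Z_(n.+2)) (c := 1)
    (P := fun x : 'Z_(n.+2) => (x \is a GRing.unit) && (ind_mod n.+2 x == delta)).
- exact: invrK.
- move=> x; rewrite unitrV; have [Ux /=|//] := boolP (x \is a GRing.unit).
  suff -> : ind_mod n.+2 x^-1 = ind_mod n.+2 x by [].
  have dvdE k : (ind_mod n.+2 x^-1 %| k = (ind_mod n.+2 x %| k))%N.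
    by rewrite !ind_mod_Zp ?unitrV // exprVn -(inj_eq invr_inj) invrK invr1.
  by apply/eqP; rewrite eqn_dvd dvdE dvdnn -dvdE dvdnn.
- case/andP=> Ux /eqP ind_x; apply/eqP => xV.
  have: (ind_mod n.+2 x %| 2)%N by rewrite ind_mod_Zp // expr2 -{1}xV mulVr.
  by rewrite ind_x gtnNdvd.
- by case/andP=> Ux _; rewrite mulrV.
- by rewrite expr1n.
Qed.

(** A square root of 1 is its own inverse, hence a unit. *)
Lemma ind_mod_eq2 (n : nat) (x : 'Z_(n.+2)) :
  (x \is a GRing.unit) && (ind_mod n.+2 x == 2%N) = (x ^+ 2 == 1) && (x != 1).
Proof.
have [Ux /=|nUx] := boolP (x \is a GRing.unit); last first.
  apply/esym/negP => /andP[/eqP x2 _]; case/negP: nUx.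
  by apply/unitrP; exists x; rewrite -expr2.
rewrite -ind_mod_Zp // -[x in x != 1]expr1 -ind_mod_Zp //.
by case: (ind_mod n.+2 x) (ind_mod_gt0 n.+2 x) => [|[|[|d]]] // _; rewrite gtnNdvd.
Qed.

Local Close Scope ring_scope.

Theorem theorem1p5 (m delta : nat) :
  0 < m -> 0 < delta -> delta %| carmichael m ->
  let P := \prod_(a < m | coprime a m && (ind_mod m a == delta)) (a : nat) in
  (delta = 2 /\ has_primitive_root m -> P = m.-1 %[mod m]) /\
  (~ (delta = 2 /\ has_primitive_root m) -> P = 1 %[mod m]).
Proof.
case: m => [|[|n]] // _ delta_gt0 _ P; first by rewrite !modn1.
have N1 : (n.+1%:R = -1 :> 'Z_(n.+2))%R.
  by apply/eqP; rewrite -addr_eq0 -mulrSr pchar_Zp.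
suff [P2 P1] : (delta = 2%N /\ has_primitive_root n.+2 -> P%:R = -1 :> 'Z_(n.+2))%R
    /\ (~ (delta = 2%N /\ has_primitive_root n.+2) -> P%:R = 1 :> 'Z_(n.+2))%R.
  split=> [/P2 PE | /P1 PE]; apply/eqP; rewrite eqn_mod_Zp PE //.
  by rewrite /= N1.
rewrite {}/P prod_ind_mod_Zp.
have [delta_gt2 | delta_le2] := ltnP 2 delta.
  by rewrite prod_ind_mod_gt2 //; split=> // -[delta2]; rewrite delta2 in delta_gt2.
case: delta delta_gt0 delta_le2 => [|[|[|]]] // _ _.
  (* Here [delta = 1], and every factor equals 1. *)
  split=> [[]//|_]; apply: big1 => x /andP[Ux /eqP ind_x].
  by apply/eqP; rewrite -[x]expr1 -ind_mod_Zp // ind_x.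
rewrite (eq_bigl _ _ (@ind_mod_eq2 n)).
case: n N1 => [|n] N1.
  (* Modulo 2 the product is empty, and 1 = -1. *)
  rewrite big_pred0; first by split=> // _; apply/val_inj.
  by case=> [[|[|i]] lt_i].
have N1_neq1 : (-1 != 1 :> 'Z_(n.+3))%R.
  by rewrite -N1 -val_eqE /= val_Zp_nat // !modn_small.
split=> [[_ /has_primitive_root_cyclic cycU] | no_root].
  apply: big_pred1 => x; apply/andP/eqP => [[/eqP x2 x_neq1] | ->].
    by case: (cyclic_units_sqrt1 cycU x2) x_neq1 => // ->; rewrite eqxx.
  by rewrite sqrrN expr1n eqxx N1_neq1.
(* Restoring the factor 1 gives the product over all square roots of 1. *)
have -> : (\prod_(x : 'Z_(n.+3) | (x ^+ 2 == 1) && (x != 1)) x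
    = \prod_(x : 'Z_(n.+3) | x ^+ 2 == 1) x)%R.
  by rewrite [RHS](bigD1 1%R) ?expr1n //= mul1r.
have [| |//|prodN1] := @prod_sqrt1 n.+1 (-1)%R; rewrite ?sqrrN ?expr1n //.
case: no_root; split=> //; apply: sqrt1_has_primitive_root => // x /eqP.
rewrite eqn_mod_Zp natrX => /eqP x2.
have [x1 | x_neq1] := eqVneq (x%:R : 'Z_(n.+3))%R 1%R.
  by left; apply/eqP; rewrite eqn_mod_Zp x1.
(* The product is already known to be -1, which is not 1; evaluating it again by means of [x] forces
   [x] to be -1. *)
right; have [] := prod_sqrt1 x2 x_neq1; rewrite prodN1 => xN1.
  by rewrite xN1 eqxx in N1_neq1.
have : x.+1 == 0 %[mod n.+3].
  by rewrite eqn_mod_Zp -[x.+1]addn1 natrD -xN1 addNr.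
by rewrite mod0n.
Qed.
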